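(* A Riemannian metric $g$ has nonnegative Ricci curvature and positive scalar curvature if and only if $\mathrm{Ein}_k(g)>0$ for all $k<0$, that is, if and only if $\mathrm{ein}(g)=-\infty$.
   Context: For a Riemannian metric $g$ and real $k$, $\mathrm{Ein}_k(g):=\mathrm{Scal}\cdot g-k\,\mathrm{Ric}$ (scalar curvature and Ricci tensor of $g$), and $\mathrm{Ein}_k>0$ means positive definite at every point. If the scalar curvature of $g$ is everywhere positive, $\mathrm{ein}(g):=\inf\{k<0:\mathrm{Ein}_k(g)>0\}$, with $\mathrm{ein}(g)=-\infty$ when that set is unbounded below; $\mathrm{ein}(g):=0$ if the scalar curvature of $g$ is not positive. *)

(* Defs.v *)
(* Manifolds are given by a smooth atlas, and tensor fields
   by their components in the charts of this atlas.  Tangent vectors are row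
   vectors: x |-> v *m 'J f x is the differential of f at x. *)
From HB Require Import structures.
From mathcomp Require Import all_boot all_order all_algebra.
From mathcomp Require Import all_classical all_reals all_analysis.

Set Implicit Arguments.
Unset Strict Implicit.
Unset Printing Implicit Defensive.

Import Order.TTheory GRing.Theory Num.Theory.
Import numFieldNormedType.Exports.

Local Open Scope classical_set_scope.
Local Open Scope ring_scope.

Definition pderiv (R : realType) (n : nat) (i : 'I_n) (f : 'rV[R]_n -> R)
    (x : 'rV[R]_n) : R :=
  'D_(delta_mx 0 i) f x.

(* Only meaningful when U is open, which is always the case below. *)
Fixpoint Ck_on (R : realType) (n : nat) (k : nat) (U : set 'rV[R]_n)
    (f : 'rV[R]_n -> R) : Prop :=
  (forall x, U x -> {for x, continuous f}) /\
  if k is k'.+1 then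
    forall i : 'I_n, (forall x, U x -> derivable f x (delta_mx 0 i)) /\
                     Ck_on k' U (pderiv i f)
  else True.

Definition smooth_on (R : realType) (n : nat) (U : set 'rV[R]_n)
    (f : 'rV[R]_n -> R) : Prop :=
  forall k, Ck_on k U f.

(* A homeomorphism from an open subset of M onto an open subset of R^n; the
   values of the two maps outside these sets are irrelevant. *)
Record chart (R : realType) (n : nat) (M : topologicalType) := Chart {
  chart_dom : set M;
  chart_map :> M -> 'rV[R]_n;
  chart_inv : 'rV[R]_n -> M;
  chart_dom_open : open chart_dom;
  chart_img_open : open (chart_map @` chart_dom);
  chart_mapK : forall p, chart_dom p -> chart_inv (chart_map p) = p;
  chart_map_cont : {within chart_dom, continuous chart_map};
  chart_inv_cont : {within chart_map @` chart_dom, continuous chart_inv}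
}.

Definition chart_img (R : realType) (n : nat) (M : topologicalType)
    (a : chart R n M) : set 'rV[R]_n :=
  a @` chart_dom a.

Definition transition (R : realType) (n : nat) (M : topologicalType)
    (a b : chart R n M) : 'rV[R]_n -> 'rV[R]_n :=
  b \o chart_inv a.

Record smooth_manifold (R : realType) (n : nat) := SmoothManifold {
  carrier :> topologicalType;
  manifold_hausdorff : hausdorff_space carrier;
  manifold_second_countable : @second_countable carrier;
  chart_index : Type;
  atlas : chart_index -> chart R n carrier;
  atlas_cover : forall p : carrier, exists a, chart_dom (atlas a) p;
  atlas_smooth : forall (a b : chart_index) (j : 'I_n),
    smooth_on (atlas a @` (chart_dom (atlas a) `&` chart_dom (atlas b)))
              (fun x => transition (atlas a) (atlas b) x 0 j)
}.

(* metric_mx a x is the Gram matrix of the coordinate frame of the chart a at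
   the point with coordinates x; it matters only on the image of the chart. *)
Record riemannian_metric (R : realType) (n : nat) (M : smooth_manifold R n) :=
  RiemannianMetric {
  metric_mx : chart_index M -> 'rV[R]_n -> 'M[R]_n;
  metric_smooth : forall (a : chart_index M) (i j : 'I_n),
    smooth_on (chart_img (atlas a)) (fun x => metric_mx a x i j);
  metric_sym : forall (a : chart_index M) x, chart_img (atlas a) x ->
    (metric_mx a x)^T = metric_mx a x;
  metric_posdef : forall (a : chart_index M) x, chart_img (atlas a) x ->
    forall v : 'rV[R]_n, v != 0 -> 0 < (v *m metric_mx a x *m v^T) 0 0;
  metric_change : forall (a b : chart_index M) (p : M),
    chart_dom (atlas a) p -> chart_dom (atlas b) p ->
    let J := jacobian (transition (atlas a) (atlas b)) (atlas a p) in
    metric_mx a (atlas a p) = J *m metric_mx b (atlas b p) *m J^T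
}.

(* The following four definitions are in local coordinates, G x being the
   matrix of the metric at the point of coordinates x. *)

(* nabla_{d_i} d_j = \sum_l (christoffel G l i j) d_l *)
Definition christoffel (R : realType) (n : nat) (G : 'rV[R]_n -> 'M[R]_n)
    (l i j : 'I_n) (x : 'rV[R]_n) : R :=
  2^-1 * \sum_m invmx (G x) l m *
    (pderiv i (fun y => G y j m) x + pderiv j (fun y => G y i m) x
     - pderiv m (fun y => G y i j) x).

(* Rm(d_i, d_j) d_k = \sum_l (riemann G l i j k) d_l, where
   Rm(X, Y) = [nabla_X, nabla_Y] - nabla_[X, Y] *)
Definition riemann (R : realType) (n : nat) (G : 'rV[R]_n -> 'M[R]_n)
    (l i j k : 'I_n) (x : 'rV[R]_n) : R :=
  pderiv i (christoffel G l j k) x - pderiv j (christoffel G l i k) x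
  + \sum_m (christoffel G m j k x * christoffel G l i m x
            - christoffel G m i k x * christoffel G l j m x).

(* Ric(Y, Z) is the trace of X |-> Rm(X, Y) Z. *)
Definition ricci_mx (R : realType) (n : nat) (G : 'rV[R]_n -> 'M[R]_n)
    (x : 'rV[R]_n) : 'M[R]_n :=
  \matrix_(j, k) \sum_i riemann G i i j k x.

Definition scalar_curv (R : realType) (n : nat) (G : 'rV[R]_n -> 'M[R]_n)
    (x : 'rV[R]_n) : R :=
  \tr (invmx (G x) *m ricci_mx G x).

Definition Ric (R : realType) (n : nat) (M : smooth_manifold R n)
    (g : riemannian_metric M) (a : chart_index M) : 'rV[R]_n -> 'M[R]_n :=
  ricci_mx (metric_mx g a).

Definition Scal (R : realType) (n : nat) (M : smooth_manifold R n)
    (g : riemannian_metric M) (a : chart_index M) : 'rV[R]_n -> R :=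
  scalar_curv (metric_mx g a).

Definition Ein (R : realType) (n : nat) (M : smooth_manifold R n) (k : R)
    (g : riemannian_metric M) (a : chart_index M) (x : 'rV[R]_n) : 'M[R]_n :=
  Scal g a x *: metric_mx g a x - k *: Ric g a x.

(* The sign conditions below do not depend on the chart around a point; they
   are required in every chart of the atlas. *)

Definition nonneg_Ric (R : realType) (n : nat) (M : smooth_manifold R n)
    (g : riemannian_metric M) : Prop :=
  forall (a : chart_index M) (x : 'rV[R]_n), chart_img (atlas a) x ->
  forall v : 'rV[R]_n, 0 <= (v *m Ric g a x *m v^T) 0 0.

Definition pos_Scal (R : realType) (n : nat) (M : smooth_manifold R n)
    (g : riemannian_metric M) : Prop :=
  forall (a : chart_index M) (x : 'rV[R]_n), chart_img (atlas a) x ->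
  0 < Scal g a x.

Definition pos_Ein (R : realType) (n : nat) (M : smooth_manifold R n) (k : R)
    (g : riemannian_metric M) : Prop :=
  forall (a : chart_index M) (x : 'rV[R]_n), chart_img (atlas a) x ->
  forall v : 'rV[R]_n, v != 0 -> 0 < (v *m Ein k g a x *m v^T) 0 0.

(* When Scal > 0 but no k < 0 qualifies (possible only if M is not compact),
   this is the infimum of the empty set, +oo. *)
Definition ein (R : realType) (n : nat) (M : smooth_manifold R n)
    (g : riemannian_metric M) : \bar R :=
  if `[< pos_Scal g >]
  then ereal_inf [set k%:E | k in [set k : R | k < 0 /\ pos_Ein k g]]
  else 0%E.

(* Main.v *)
(* Only the trace needs an argument beyond bilinearity: if Ein_{-1} > 0, then
   its trace with respect to g, which is (n + 1) Scal, is positive, whence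
   Scal > 0.  Letting k tend to -oo in Ein_k > 0 gives Ric >= 0.  When Scal > 0,
   Ein_k lies on the segment from Ein_0 = Scal g > 0 to Ein_k' for all
   k' < k < 0, so the k < 0 with Ein_k > 0 form an interval ending at 0, which
   is unbounded below iff it contains every k < 0. *)
Require Import Defs.
From mathcomp Require Import all_boot all_order all_algebra.
From mathcomp Require Import all_classical all_reals all_analysis.
From mathcomp Require Import ring lra.
Import Order.TTheory GRing.Theory Num.Theory.
Local Open Scope classical_set_scope.
Local Open Scope ring_scope.

(** Symmetry is kept as a separate hypothesis, so that [pos_Ein] is literally this condition on each
    matrix [Ein k g a x]. *)
Definition posdef_mx {R : realType} {n : nat} (A : 'M[R]_n) : Prop :=
  forall v : 'rV[R]_n, v != 0 -> 0 < (v *m A *m v^T) 0 0.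

Lemma posdef_mx_unit (R : realType) (n : nat) (A : 'M[R]_n) :
  posdef_mx A -> A \in unitmx.
Proof.
move=> Apos; rewrite -row_free_unit; apply/inj_row_free => v vA0.
apply/eqP/negP => /negP /Apos.
by rewrite vA0 mul0mx mxE ltxx.
Qed.

(* Elimination of the first row and column: the Schur complement of the first
   entry is again symmetric positive definite. *)
Lemma posdef_mx_cholesky (R : realType) (n : nat) (G : 'M[R]_n) :
  G^T = G -> posdef_mx G -> exists P : 'M[R]_n, G = P^T *m P.
Proof.
elim: n G => [|n IH] G Gsym Gpos.
  by exists 0; apply/matrixP => -[].
pose G' : 'M[R]_(1 + n) := G.
pose b := ursubmx G'; pose C := drsubmx G'.
have Eb : dlsubmx G' = b^T by rewrite /b trmx_ursub /G' Gsym.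
have Csym : C^T = C by rewrite /C trmx_drsub /G' Gsym.
pose a := ulsubmx G' 0 0.
have Ea : ulsubmx G' = a%:M by exact: mx11_scalar.
have EG : G' = block_mx a%:M b b^T C by rewrite -(submxK G') Ea Eb.
have quad (s : R) (w : 'rV[R]_n) :
    let v : 'rV[R]_(1 + n) := row_mx s%:M w in
    (v *m G' *m v^T) 0 0
    = s * s * a + 2 * s * (b *m w^T) 0 0 + (w *m C *m w^T) 0 0.
  have Ebw : (w *m b^T) 0 0 = (b *m w^T) 0 0.
    by rewrite -[w *m b^T]trmxK trmx_mul trmxK [LHS]mxE.
  have D x y : (x + y : 'M[R]_1) 0 0 = x 0 0 + y 0 0 by rewrite mxE.
  have Z c x : (c *: x : 'M[R]_1) 0 0 = c * x 0 0 by rewrite mxE.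
  rewrite /= EG mul_row_block tr_row_mx mul_row_col !mulmxDl tr_scalar_mx.
  rewrite !mul_mx_scalar !mul_scalar_mx -!scalemxAl !D !Z Ebw mxE eqxx.
  by rewrite mulr1n; ring.
have a_gt0 : 0 < a.
  have /Gpos : (row_mx 1%:M 0 : 'rV[R]_(1 + n)) != 0.
    by rewrite row_mx_eq0 negb_and matrix_nonzero1.
  have M0 : (0 : 'M[R]_1) 0 0 = 0 by rewrite mxE.
  by rewrite quad trmx0 !mul0mx mulmx0 M0 mulr0 !addr0 !mul1r.
pose S := C - a^-1 *: (b^T *m b).
have Ssym : S^T = S.
  by rewrite /S linearB linearZ /= trmx_mul trmxK Csym.
have Spos : posdef_mx S.
  (* The first coordinate [- t / a] minimizes the quadratic polynomial in [s] given by [quad]; the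
     minimum is the value of [S] at [w]. *)
  move=> w w0; pose t := (b *m w^T) 0 0.
  have /Gpos : (row_mx (- t / a)%:M w : 'rV[R]_(1 + n)) != 0.
    by rewrite row_mx_eq0 negb_and w0 orbT.
  rewrite quad -/t /S mulmxBr mulmxBl -scalemxAr -scalemxAl.
  suff -> : w *m (b^T *m b) *m w^T = (t * t)%:M.
    rewrite !mxE mulr1n.
    set c := \sum_j _.
    suff -> : - t / a * (- t / a) * a + 2 * (- t / a) * t + c
              = c - a^-1 * (t * t) by [].
    by field; rewrite gt_eqF.
  rewrite mulmxA -mulmxA [b *m w^T]mx11_scalar -/t.
  rewrite -[w *m b^T]trmxK trmx_mul trmxK [b *m w^T]mx11_scalar -/t.
  by rewrite tr_scalar_mx -scalar_mxM.
have [Q EQ] := IH S Ssym Spos.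
pose s := Num.sqrt a.
have ss : s * s = a by rewrite -expr2 sqr_sqrtr// ltW.
have s0 : s != 0 by rewrite sqrtr_eq0 -ltNge.
(* The lower right block of [P^T *m P] is [a^-1 *: (b^T *m b) + S], which is [C]. *)
pose P : 'M[R]_(1 + n) := block_mx s%:M (s^-1 *: b) 0 Q.
suff EP : G' = P^T *m P by exists P.
have trZ : (s^-1 *: b)^T = s^-1 *: b^T by rewrite linearZ.
rewrite EG /P tr_block_mx mulmx_block tr_scalar_mx trZ.
rewrite -EQ /S trmx0 !mul0mx !mulmx0 !addr0 -scalar_mxM ss.
rewrite mul_scalar_mx mul_mx_scalar !scalerA divff// !scale1r.
rewrite -scalemxAl -scalemxAr scalerA -invfM ss.
by rewrite addrCA subrr addr0.
Qed.

(** Writing the inverse of [G] as [Q^T *m Q] turns the trace into that of [Q *m A *m Q^T], whose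
    diagonal entries are the values of [A] on the nonzero rows of [Q]. *)
Lemma mxtrace_invmx_posdef_gt0 (R : realType) (n : nat) (G A : 'M[R]_n) :
  (0 < n)%N -> G^T = G -> posdef_mx G -> posdef_mx A ->
  0 < \tr (invmx G *m A).
Proof.
move=> n_gt0 Gsym Gpos Apos.
have [P EP] := posdef_mx_cholesky _ _ _ Gsym Gpos.
have := posdef_mx_unit _ _ _ Gpos.
rewrite EP unitmx_mul unitmx_tr andbb => Pu.
pose Q := (invmx P)^T.
have -> : invmx (P^T *m P) = Q^T *m Q.
  rewrite /Q trmxK trmx_inv; apply: (can_inj (mulKmx (_ : P^T *m P \in unitmx))).
    by rewrite unitmx_mul unitmx_tr Pu.
  rewrite mulmxV ?unitmx_mul ?unitmx_tr ?Pu //.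
  by rewrite mulmxA -(mulmxA _ P) mulmxV // mulmx1 mulmxV // unitmx_tr.
rewrite -mulmxA mxtrace_mulC.
have rowQ i : row i Q != 0.
  apply/eqP => Qi0.
  have Qf : row_free Q by rewrite row_free_unit unitmx_tr unitmx_inv.
  have /(row_free_inj Qf) : delta_mx 0 i *m Q = (0 : 'rV_n) *m Q.
    by rewrite -rowE Qi0 mul0mx.
  by move/matrixP/(_ 0 i)/eqP; rewrite !mxE !eqxx oner_eq0.
have Qii i : (Q *m A *m Q^T) i i = (row i Q *m A *m (row i Q)^T) 0 0.
  by rewrite -row_mul tr_row -[RHS]/((row i (Q *m A) *m col i Q^T) 0 0)
     !mxE; apply: eq_bigr => j _; rewrite !mxE.
(* One diagonal entry, available since [0 < n], gives strictness. *)
rewrite /mxtrace (bigD1 (Ordinal n_gt0)) //= Qii.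
apply: ltr_pwDl; first exact: Apos.
by apply: sumr_ge0 => i _; rewrite Qii; apply/ltW/Apos.
Qed.

Section EinSign.
Context {R : realType} {n : nat} {M : smooth_manifold R n}.
Context (g : riemannian_metric M).

Lemma Ein_quad (k : R) (a : chart_index M) (x v : 'rV[R]_n) :
  (v *m Ein k g a x *m v^T) 0 0 =
  Scal g a x * (v *m metric_mx g a x *m v^T) 0 0
  - k * (v *m Ric g a x *m v^T) 0 0.
Proof.
by rewrite /Ein mulmxBr mulmxBl -!scalemxAr -!scalemxAl !mxE.
Qed.

Lemma tr_Ein (k : R) (a : chart_index M) (x : 'rV[R]_n) :
  chart_img (atlas a) x ->
  \tr (invmx (metric_mx g a x) *m Ein k g a x) = (n%:R - k) * Scal g a x.
Proof.
move=> ax; have Gu := posdef_mx_unit _ _ _ (metric_posdef g ax : posdef_mx _).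
rewrite /Ein mulmxBr -!scalemxAr mulVmx // linearB /= !mxtraceZ mxtrace1.
by rewrite -[\tr _]/(Scal g a x) mulrBl [n%:R * _]mulrC.
Qed.

(** By [tr_Ein], the positive trace is [Scal] times [n%:R - k], a positive factor for [k < 0]. *)
Lemma pos_Ein_Scal (k : R) :
  (0 < n)%N -> k < 0 -> pos_Ein k g -> pos_Scal g.
Proof.
move=> n_gt0 k_lt0 Ek a x ax.
have := mxtrace_invmx_posdef_gt0 _ _ _ _ n_gt0 (Defs.metric_sym g ax)
  (metric_posdef g ax) (Ek a x ax).
by rewrite tr_Ein // pmulr_rgt0 // subr_gt0 (lt_le_trans k_lt0).
Qed.

Lemma pos_Ein_of_Ric_Scal (k : R) :
  nonneg_Ric g -> pos_Scal g -> k < 0 -> pos_Ein k g.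
Proof.
move=> Rge Sgt k_lt0 a x ax v v0; rewrite Ein_quad.
apply: ltr_pwDl; first by rewrite mulr_gt0 ?Sgt ?metric_posdef.
by rewrite -mulNr mulr_ge0 ?Rge// oppr_ge0 ltW.
Qed.

Lemma nonneg_Ric_of_pos_Ein :
  (forall k : R, k < 0 -> pos_Ein k g) -> nonneg_Ric g.
Proof.
move=> E a x ax v; have [->|v0] := eqVneq v 0.
  by rewrite !mul0mx mxE.
rewrite leNgt; apply/negP => r_lt0.
set r := (X in X < 0) in r_lt0.
pose c := Scal g a x * (v *m metric_mx g a x *m v^T) 0 0.
(* This [k] solves [k * r = |c| + 1], so [Ein k] takes the negative value [c - |c| - 1] at [v]. *)
have k_lt0 : - (`|c| + 1) / - r < 0.
  by rewrite pmulr_llt0 ?invr_gt0 ?oppr_gt0// oppr_lt0 ltr_wpDl.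
have := E _ k_lt0 a x ax v v0; rewrite Ein_quad -/c -/r.
have -> : - (`|c| + 1) / - r * r = `|c| + 1 by field; rewrite lt_eqF.
by have := ler_norm c; lra.
Qed.

Lemma pos_Ein_le (k k' : R) :
  pos_Scal g -> k' <= k -> k < 0 -> pos_Ein k' g -> pos_Ein k g.
Proof.
move=> Sgt lek k_lt0 E a x ax v v0.
have := E a x ax v v0; rewrite !Ein_quad.
have : 0 < Scal g a x * (v *m metric_mx g a x *m v^T) 0 0.
  by rewrite mulr_gt0 ?Sgt ?metric_posdef.
set c := Scal g a x * _; set r := (v *m Ric g a x *m _) 0 0 => c_gt0 E'.
(* If [0 <= r], then [c - k * r >= c > 0]; if [r < 0], then [c - k * r >= c - k' * r > 0]. *)
have [r_ge0|r_lt0] := leP 0 r; nra.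
Qed.

End EinSign.

Theorem proposition2p7 (R : realType) (n : nat) (hn : (0 < n)%N)
    (M : smooth_manifold R n) (g : riemannian_metric M) :
  (nonneg_Ric g /\ pos_Scal g <-> forall k : R, k < 0 -> pos_Ein k g) /\
  ((forall k : R, k < 0 -> pos_Ein k g) <-> ein g = -oo%E).
Proof.
have Scal_of_Ein : (forall k : R, k < 0 -> pos_Ein k g) -> pos_Scal g.
  by move=> E; apply: (pos_Ein_Scal g (-1) hn _ (E _ _)); rewrite ltrN10.
split; split.
- by move=> [? ?] k; apply: pos_Ein_of_Ric_Scal.
- by move=> E; split; [exact: nonneg_Ric_of_pos_Ein|exact: Scal_of_Ein].
- move=> E; rewrite /ein asboolT; last exact: Scal_of_Ein.
  set l := ereal_inf _.
  have le_l (k : R) : k < 0 -> (l <= k%:E)%E.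
    move=> k_lt0; apply: ereal_inf_lbound.
    by exists k => //; split => //; exact: E.
  case: l le_l => [r||] // le_l; last by have := le_l (-1) (ltrN10 _).
  (* A finite infimum [r] is refuted by a negative number strictly below it. *)
  have k_lt0 : - `|r| - 1 < 0 by have := normr_ge0 r; lra.
  exfalso; have := le_l _ k_lt0; rewrite lee_fin.
  by have := ler_norm (- r); rewrite normrN; lra.
(* The default value 0 differs from [-oo], so [Scal] is positive; an admissible [k'] below [k] then
   suffices. *)
- rewrite /ein; case: asboolP => // Sgt Einf k k_lt0.
  have [_ [k' [_ E'] <-]] := lb_ereal_infNy_adherent k Einf.
  by rewrite lte_fin => /ltW lek; apply: pos_Ein_le E'.
Qed.
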